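(* The Polynomial Sarnak Conjecture for minimal systems is false. That is, there exist a minimal topological dynamical system $(X,T)$ of topological entropy zero, a function $f\in C(X)$, a polynomial $p:\mathbb{N}\to\mathbb{N}_0$ and a point $x\in X$ such that the statement $$\lim_{N\to\infty}\frac{1}{N}\sum_{n=1}^{N}\mu(n)f(T^{p(n)}x)=0$$ does not hold.
   Context: $\mathbb{N}=\{1,2,\dots\}$ and $\mathbb{N}_0=\mathbb{N}\cup\{0\}$. The Möbius function $\mu:\mathbb{N}\to\{-1,0,1\}$ is given by $\mu(1)=1$, $\mu(n)=(-1)^k$ if $n$ is a product of $k$ distinct primes, and $\mu(n)=0$ otherwise. A topological dynamical system $(X,T)$ consists of a compact metrizable space $X$ and a homeomorphism $T:X\to X$. It is minimal if the orbit $\{T^nx:n\in\mathbb{Z}\}$ of every point $x\in X$ is dense in $X$. $C(X)$ is the space of continuous functions on $X$. Polynomial Sarnak Conjecture for minimal systems: for every minimal topological dynamical system $(X,T)$ with topological entropy zero, $\lim_{N\to\infty}\frac1N\sum_{n=1}^N\mu(n)f(T^{p(n)}x)=0$ holds for every $f\in C(X)$, every polynomial $p:\mathbb{N}\to\mathbb{N}_0$ and every $x\in X$. *)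

(* Defs.v *)
From HB Require Import structures.
From mathcomp Require Import all_boot all_order all_algebra.
From mathcomp Require Import all_classical all_reals all_analysis.

Set Implicit Arguments.
Unset Strict Implicit.
Unset Printing Implicit Defensive.

Import Order.TTheory GRing.Theory Num.Theory.
Import numFieldNormedType.Exports.

Local Open Scope classical_set_scope.
Local Open Scope ring_scope.

(* [primes n] lists the prime divisors of [n] without repetition, so [n > 0] is
   a product of distinct primes iff each of them has valuation 1. *)
Definition moebius (n : nat) : int :=
  if (0 < n)%N && all (fun p => logn p n == 1%N) (primes n)
  then (-1) ^+ size (primes n) else 0.

(* A polynomial function from {1, 2, ...} to {0, 1, 2, ...}. The coefficients
   may be rational, as in n(n+1)/2; interpolation shows that real coefficients
   would not give more functions. *)
Definition polynomial_map (p : nat -> nat) : Prop :=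
  exists P : {poly rat}, forall n : nat, (0 < n)%N -> P.[n%:R] = (p n)%:R.

Record homeo (X Y : topologicalType) := Homeo {
  homeo_fun :> X -> Y;
  homeo_inv : Y -> X;
  homeo_funK : cancel homeo_fun homeo_inv;
  homeo_invK : cancel homeo_inv homeo_fun;
  homeo_continuous : continuous homeo_fun;
  homeo_inv_continuous : continuous homeo_inv }.

Definition metrizable (R : realType) (X : topologicalType) : Prop :=
  exists M : metricType R, inhabited (homeo X M).

Definition homeo_pow (X : topologicalType) (T : homeo X X) (n : int) : X -> X :=
  match n with
  | Posz k => iter k T
  | Negz k => iter k.+1 (homeo_inv T)
  end.

Definition orbit (X : topologicalType) (T : homeo X X) (x : X) : set X :=
  range (fun n : int => homeo_pow T n x).

Definition minimal (X : topologicalType) (T : homeo X X) : Prop :=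
  forall x : X, dense (orbit T x).

(* Topological entropy, in the open-cover definition of Adler, Konheim and
   McAndrew: h(T) is the supremum over the open covers U of X of
     lim_n (1/n) log N(U \/ T^-1 U \/ ... \/ T^-(n-1) U),
   where N(V) is the least cardinality of a subcover of V. *)
Section Entropy.
Variable X : topologicalType.
Implicit Types U V : set (set X).

Definition open_cover U : Prop :=
  (forall A, U A -> open A) /\ \bigcup_(A in U) A = [set: X].

Definition cover_join U V : set (set X) := [set A `&` B | A in U & B in V].

Definition cover_preimage (f : X -> X) U : set (set X) := preimage f @` U.

Fixpoint cover_refine (f : X -> X) U (n : nat) : set (set X) :=
  if n is m.+1 then cover_join U (cover_preimage f (cover_refine f U m))
  else [set [set: X]].

Definition has_subcover U (n : nat) : Prop :=
  exists s : seq (set X),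
    [/\ size s = n, [set` s] `<=` U & \bigcup_(A in [set` s]) A = [set: X]].

(* For an open cover of a compact space the set below is a nonempty set of
   natural numbers, so that the infimum is a minimum. *)
Definition cover_number (R : realType) U : R :=
  inf [set n%:R | n in has_subcover U].

(* On a compact space the limit exists, because log N is subadditive in n. *)
Definition cover_entropy (R : realType) (f : X -> X) U : \bar R :=
  limn (fun n : nat => (ln (cover_number R (cover_refine f U n)) / n%:R)%:E).

Definition topological_entropy (R : realType) (f : X -> X) : \bar R :=
  ereal_sup [set cover_entropy R f U | U in open_cover].

End Entropy.

(* Main.v *)
Require Import Defs.
From HB Require Import structures.
From mathcomp Require Import all_boot all_order all_algebra.
From mathcomp Require Import all_classical all_reals all_analysis.
From mathcomp Require Import zify ring lra.

Set Implicit Arguments.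
Unset Strict Implicit.
Unset Printing Implicit Defensive.

Import Order.TTheory GRing.Theory Num.Theory.
Import numFieldNormedType.Exports.

Local Open Scope classical_set_scope.
Local Open Scope ring_scope.

(** A Toeplitz sequence [mtoeplitz] in {0,1}^Z is built so that its value at n^2
is 1 exactly when mu(n) = 1, for all n outside a set of small density along a
sequence of scales N. With p(n) = n^2, with the sequence itself as the point x,
and with f = 1 on sequences having 1 at the origin and f = -1 elsewhere, such an
n contributes mu(n) f(T^(n^2) x) = |mu(n)|. Since at least a quarter of the integers up
to N are squarefree, the averages stay at least 1/8 along these scales
([sum_moebius_mtoeplitz]).

The sequence is filled in stages. Stage k prescribes the values on
(-reach k, reach k) and repeats them with period [modulus k], wherever an
earlier stage has not decided already; the moduli divide one another and
modulus k is far larger than reach k. Every window around the origin therefore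
recurs periodically, which makes the orbit closure minimal
([minimal_hull_shift]).

The same repetition spoils the values wanted at later squares, and the
construction works because squares are sparse. Let N be the modulus of stage K.
The next stage reaches beyond N^2, so n <= N is spoiled only if n^2 falls in the
part filled by a stage k <= K. As modulus k is divisible by 4^m with m large, and
squaring modulo 4^m has fibres with at most 2^(m+1) elements, this happens for at
most N / 2^(k+5) values of n ([sum_filled_sqr]). The total loss is at most N/16.

For zero entropy, modulus k is also a multiple of a number [sqmod k] modulo which
at most a fraction (2/3)^k of the residues are squares ([size_sqs_sqmod]). A
symbol 1 that is not placed by the stages up to K sits at a square modulo
sqmod K. Hence a word of length n is determined by its position modulo modulus K
and by about (2/3)^K n further bits, and K is arbitrary
([few_words_mtoeplitz]). *)

(** * The hull of a two-sided binary sequence *)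

Definition agree (k : nat) (y z : int -> bool) :=
  forall i : int, (`|i|%N < k)%N -> y i = z i.

Lemma agree_refl k y : agree k y y. Proof. by []. Qed.

Lemma agree_sym k y z : agree k y z -> agree k z y.
Proof. by move=> h i /h. Qed.

Lemma agree_trans k x y z : agree k x y -> agree k y z -> agree k x z.
Proof. by move=> xy yz i ik; rewrite xy// yz. Qed.

Lemma agree_le k l y z : (k <= l)%N -> agree l y z -> agree k y z.
Proof. by move=> kl h i ik; rewrite h// (leq_trans ik). Qed.

Lemma agree_all y z : (forall k, agree k y z) -> y = z.
Proof. by move=> h; apply/funext => i; apply: (h `|i|.+1%N). Qed.

Definition in_hull (u y : int -> bool) :=
  forall k, exists t : int, agree k y (fun i => u (t + i)).

(** The field [R] only selects where the metric below takes its values. *)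
Definition hull (R : realType) (u : int -> bool) : Type :=
  {y : int -> bool | in_hull u y}.

Section HullMetric.
Context (R : realType) (u : int -> bool).
Local Notation X := (hull R u).

HB.instance Definition _ := gen_eqMixin X.
HB.instance Definition _ := gen_choiceMixin X.

(** The distance is 1/(k+1) for the largest k such that the two sequences agree on
(-k, k); the infimum also covers equal sequences. *)
Definition agree_radii (y z : X) : set R :=
  [set k.+1%:R^-1 | k in [set k | agree k (sval y) (sval z)]].

Definition hull_dist (y z : X) : R := inf (agree_radii y z).

Let has_inf_radii (y z : X) : has_inf (agree_radii y z).
Proof.
split; first by exists 1; exists 0%N => //=; rewrite invr1.
by exists 0 => _ [k _ <-].
Qed.

Let hull_dist_ge0 (y z : X) : 0 <= hull_dist y z.
Proof.
by apply: lb_le_inf; [exact: (has_inf_radii y z).1|move=> _ [k _ <-]].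
Qed.

Let hull_distP (y z : X) (e : R) : hull_dist y z < e <->
  exists2 k, agree k (sval y) (sval z) & k.+1%:R^-1 < e.
Proof.
split.
  by move=> /inf_lt[|_ [k kyz <-] ke]; [exact: (has_inf_radii y z).1|exists k].
move=> [k kyz]; apply: le_lt_trans; apply: ge_inf; last by exists k.
exact: (has_inf_radii y z).2.
Qed.

Let hull_dist_le (y z : X) k :
  agree k (sval y) (sval z) -> hull_dist y z <= k.+1%:R^-1.
Proof. by move=> h; apply: ge_inf; [exact: (has_inf_radii y z).2|exists k]. Qed.

Lemma hull_dist_agree (y z : X) k :
  hull_dist y z < k.+1%:R^-1 -> agree k (sval y) (sval z).
Proof.
move=> /hull_distP[l yz]; rewrite ltf_pV2 ?posrE// ltr_nat ltnS => kl.
exact: agree_le (ltnW kl) yz.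
Qed.

Let hull_distxx y : hull_dist y y = 0.
Proof.
apply/eqP; rewrite eq_le hull_dist_ge0 andbT leNgt; apply/negP => h.
have [k] := ltr_add_invr h; rewrite add0r => kd.
by have := hull_dist_le (@agree_refl k (sval y)); rewrite leNgt kd.
Qed.

Let hull_dist_eq0 y z : hull_dist y z = 0 -> y = z.
Proof.
move=> yz; have : sval y = sval z.
  by apply/agree_all => k; apply: hull_dist_agree; rewrite yz.
by case: y z {yz} => y Py [z Pz] /=; exact: eq_exist.
Qed.

Let hull_dist_sym y z : hull_dist y z = hull_dist z y.
Proof.
rewrite /hull_dist; congr (inf _).
by apply/seteqP; split => _ [k yz <-]; exists k => //; exact: agree_sym.
Qed.

Let hull_dist_triangle y x z : hull_dist x z <= hull_dist x y + hull_dist y z.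
Proof.
rewrite leNgt; apply/negP => h.
have /hull_distP[k xy kh] : hull_dist x y < hull_dist x z.
  by apply: le_lt_trans h; rewrite lerDl.
have /hull_distP[l yz lh] : hull_dist y z < hull_dist x z.
  by apply: le_lt_trans h; rewrite lerDr.
wlog kl : k l x z xy yz {h} kh lh / (k <= l)%N => [H|].
  have [kl|/ltnW lk] := leqP k l; first exact: (H k l x z).
  by apply: (H l k z x) => //; rewrite 1?hull_dist_sym//; exact: agree_sym.
have := hull_dist_le (agree_trans xy (agree_le kl yz)).
by rewrite leNgt kh.
Qed.

HB.instance Definition _ := isMetric.Build R X
  hull_distxx hull_dist_eq0 hull_dist_sym hull_dist_triangle.

Lemma nbhs_hullP (y : X) (A : set X) :
  nbhs y A <-> exists k, forall z : X, agree k (sval y) (sval z) -> A z.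
Proof.
split.
  move=> /nbhs_ballP[e /= e0 yA].
  have [k] := ltr_add_invr e0; rewrite add0r => ke.
  exists k => z yz; apply: yA; rewrite ballEmdist /=.
  exact: le_lt_trans (hull_dist_le yz) ke.
move=> [k kA]; apply/nbhs_ballP; exists k.+1%:R^-1 => //= z.
by rewrite ballEmdist /= => /hull_dist_agree/kA.
Qed.

Lemma near_agree (y : X) k : \forall z \near y, agree k (sval y) (sval z).
Proof. by apply/nbhs_hullP; exists k. Qed.

Lemma metrizable_hull : metrizable R X.
Proof.
by exists X; constructor; exists id id => //; move=> x; exact: cvg_id.
Qed.

(** Along an ultrafilter every coordinate is eventually constant, and the sequence
of these constants is in the hull because each of its windows is a window of
some member. *)
Lemma compact_hull : compact [set: X].
Proof.
rewrite compact_ultra => F FU _.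
pose y i := `[< F [set z : X | sval z i] >].
have Fy i : F [set z : X | sval z i = y i].
  rewrite /y; case: asboolP => [h|h]; first by apply: filterS h => z /= ->.
  have [//|] := in_ultra_setVsetC [set z : X | sval z i] FU.
  by apply: filterS => z /= /negP/negbTE.
have Fagree k : F [set z : X | agree k y (sval z)].
  elim: k => [|k IH]; first by apply: filterS filterT => z _ i.
  apply: filterS (filterI IH (filterI (Fy k%:Z) (Fy (- k%:Z)))).
  move=> z [/= zk [zp zn]] i; rewrite ltnS leq_eqVlt => /orP[/eqP ik|/zk//].
  have [->|->] : i = k%:Z \/ i = - k%:Z by lia.
    by rewrite zp.
  by rewrite zn.
have yX : in_hull u y.
  move=> k; have /filter_ex[z zk] := Fagree k.
  have [t zt] := svalP z k; exists t; exact: agree_trans zk zt.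
exists (exist _ y yX); split=> // A /nbhs_hullP[k kA].
by apply: filterS (Fagree k) => z /kA.
Qed.

End HullMetric.

(** * Minimality and entropy of the shift *)

Section Shift.
Context (R : realType) (u : int -> bool).
Local Notation X := (hull R u).

Lemma in_hull_base : in_hull u u.
Proof. by move=> k; exists 0 => i _; rewrite add0r. Qed.

Definition hull_base : X := exist _ u in_hull_base.

Lemma in_hull_translate (n : int) (y : X) :
  in_hull u (fun i => sval y (i + n)).
Proof.
move=> k; have [t yt] := svalP y (k + `|n|)%N.
by exists (t + n) => i ik; rewrite yt; [congr u; lia|lia].
Qed.

Definition translate (n : int) (y : X) : X :=
  exist _ _ (in_hull_translate n y).

Lemma translate_translate m n y : translate m (translate n y) = translate (m + n) y.
Proof. by apply: eq_exist; apply/funext => i /=; rewrite addrA. Qed.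

Lemma translate0 y : translate 0 y = y.
Proof.
case: y => y yP; apply: eq_exist; apply/funext => i /=.
by rewrite addr0.
Qed.

Lemma translate_continuous n : continuous (translate n).
Proof.
move=> y A /nbhs_hullP[k kA]; apply/nbhs_hullP; exists (k + `|n|)%N => z yz.
by apply: kA => i ik; apply: yz; lia.
Qed.

Lemma translateK n : cancel (translate n) (translate (- n)).
Proof. by move=> y; rewrite translate_translate addNr translate0. Qed.

Lemma translateNK n : cancel (translate (- n)) (translate n).
Proof. by move=> y; rewrite translate_translate addrN translate0. Qed.

Definition hull_shift : homeo X X :=
  Homeo (translateK 1) (translateNK 1)
        (@translate_continuous 1) (@translate_continuous (- 1)).

Lemma homeo_pow_shift n y : homeo_pow hull_shift n y = translate n y.
Proof.
have iterE m k : iter k (translate m) y = translate (m *+ k) y.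
  elim: k => [|k IH]; first by rewrite mulr0n translate0.
  by rewrite iterS IH translate_translate mulrS.
case: n => k /=; first by rewrite iterE natz.
by rewrite iterE translate_translate -mulrS NegzE mulNrn natz.
Qed.

Definition toeplitz := forall k : nat, exists2 M : nat, (0 < M)%N &
  forall t i : int, (`|i|%N < k)%N -> u (i + t * M%:Z) = u i.

(** Any member of the hull shows a window of [u] of length exceeding the period M of
the block to be found, so it contains that block at a multiple of M. *)
Lemma minimal_hull_shift : toeplitz -> minimal hull_shift.
Proof.
move=> uT y O [z Oz] oO.
have /nbhs_hullP[k kO] : nbhs z O by apply: open_nbhs_nbhs.
have [t zt] := svalP z k.
have [M M0 Mu] := uT (k + `|t|)%N.
have [s ys] := svalP y (M + k + `|t|)%N.
have jM := modz_ge0 (- s) (_ : M%:Z != 0); have {}jM := jM ltac:(lia).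
have Mj := ltz_pmod (- s) (_ : 0 < M%:Z); have {}Mj := Mj ltac:(lia).
set j := modz (- s) M%:Z in jM Mj.
have sj : s + j = - divz (- s) M%:Z * M%:Z.
  by have := divz_eq (- s) M%:Z; rewrite -/j; lia.
exists (translate (j + t) y); split; last first.
  by exists (j + t) => //; rewrite homeo_pow_shift.
apply: kO => i ik /=; rewrite zt// ys; last by lia.
have -> : s + (i + (j + t)) = (t + i) + - divz (- s) M%:Z * M%:Z.
  by rewrite -sj; ring.
by rewrite Mu//; lia.
Qed.

(** Lebesgue number lemma for the hull. *)
Lemma open_cover_agree (U : set (set X)) : open_cover U ->
  exists m, forall y : X, exists2 A, U A & forall z : X, agree m (sval y) (sval z) -> A z.
Proof.
move=> [Uo Ucov].
pose P m (y : X) := exists2 A, U A & forall z : X, agree m (sval y) (sval z) -> A z.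
suff [m _ mP] : \forall m \near \oo, [set: X] `<=` P m.
  by exists m => y; exact: (mP m (leqnn _)).
have /compact_near_coveringP := @compact_hull R u; apply.
move=> y _; have [A UA Ay] : (\bigcup_(A in U) A) y by rewrite Ucov.
have /nbhs_hullP[k kA] : nbhs y A by apply: open_nbhs_nbhs; split => //; exact: Uo.
exists ([set z : X | agree k (sval y) (sval z)], [set m | (k <= m)%N]).
  by split; [exact: near_agree|exists k].
move=> [z m] /= [yz km]; exists A => // w zw; apply: kA.
exact: agree_trans yz (agree_le km zw).
Qed.

Lemma cover_refine_agree (U : set (set X)) m :
  (forall y : X, exists2 A, U A & forall z : X, agree m (sval y) (sval z) -> A z) ->
  forall n (y : X), exists2 A, cover_refine hull_shift U n A & forall z : X,
    (forall i : int, - m%:Z < i < n%:Z + m%:Z -> sval y i = sval z i) -> A z.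
Proof.
move=> Um; elim=> [|n IH] y /=; first by exists [set: X].
have [A UA Ay] := Um y; have [B RB By] := IH (translate 1 y).
exists (A `&` translate 1 @^-1` B).
  by exists A => //; exists (translate 1 @^-1` B) => //; exists B.
move=> z yz; split; first by apply: Ay => i im; apply: yz; lia.
by apply: By => i im /=; apply: yz; lia.
Qed.

(** A code of the words of length n + 2m determines, for each point, an element of
the n-th refinement that contains it, so there is a subcover indexed by codes. *)
Lemma cover_number_code (U : set (set X)) m n (C : finType) (c : int -> C) :
  (forall y : X, exists2 A, U A & forall z : X, agree m (sval y) (sval z) -> A z) ->
  (forall s t, c s = c t ->
    forall i, (i < n + m + m)%N -> u (s + i%:Z) = u (t + i%:Z)) ->
  1 <= cover_number R (cover_refine hull_shift U n) <= #|C|%:R.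
Proof.
move=> Um cP.
have /choice[A AP] (y : X) : exists A, cover_refine hull_shift U n A /\
    forall z : X, (forall i : int, - m%:Z < i < n%:Z + m%:Z ->
      sval y i = sval z i) -> A z.
  by have [A ? ?] := cover_refine_agree Um n y; exists A.
have /choice[t tP] (y : X) := svalP y (n + m)%N.
pose repr c0 := xget hull_base [set y | c (t y - m%:Z) = c0].
have sub : has_subcover (cover_refine hull_shift U n) #|C|.
  exists [seq A (repr c0) | c0 <- enum C]; split.
  - by rewrite size_map cardE.
  - by move=> B /mapP[c0 _ ->]; exact: (AP _).1.
  - apply/seteqP; split => // y _; set c0 := c (t y - m%:Z).
    exists (A (repr c0)); first by apply: map_f; rewrite mem_enum.
    have /cP rw : c (t (repr c0) - m%:Z) = c0.
      by apply: (@xgetPex _ hull_base [set y | c (t y - m%:Z) = c0]); exists y.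
    apply: (AP _).2 => i /andP[im inm]; rewrite !tP; [|lia|lia].
    have [l lE] : exists l : nat, i = l%:Z - m%:Z.
      by exists (absz (i + m%:Z)); lia.
    by have := rw l ltac:(lia); rewrite lE !addrA !(addrAC _ _ (- m%:Z)).
apply/andP; split; last first.
  by apply: ge_inf; [exists 0 => _ [k _ <-]|exists #|C|].
apply: lb_le_inf; first by exists #|C|%:R; exists #|C|.
move=> _ [k [s [<- _ sU]] <-]; rewrite ler1n lt0n.
apply/negP => /nilP s0; have : [set: X] hull_base by [].
by rewrite -sU s0 => -[].
Qed.

(** Subexponential word complexity of [u], with the number of words bounded by that
of the values of a code. *)
Definition few_words := forall e : R, 0 < e -> \forall n \near \oo,
  exists (C : finType) (c : int -> C),
    (forall s t, c s = c t ->
      forall i, (i < n)%N -> u (s + i%:Z) = u (t + i%:Z)) /\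
    ln (#|C|%:R) <= e * n%:R.

Lemma cover_entropy_shift (U : set (set X)) :
  few_words -> open_cover U -> cover_entropy R hull_shift U = 0%E.
Proof.
move=> uW /open_cover_agree[m Um]; apply/cvg_lim => //.
apply: cvg_EFin; first by near=> n.
apply/cvgr0Pnorm_le => e e0.
have e20 : 0 < e / 2 by rewrite divr_gt0.
have [N _ NP] := uW _ e20.
near=> n => /=.
have [C [c [cP Ce]]] : exists (C : finType) (c : int -> C),
    (forall s t, c s = c t ->
      forall i, (i < n + m + m)%N -> u (s + i%:Z) = u (t + i%:Z)) /\
    ln (#|C|%:R) <= e / 2 * (n + m + m)%:R.
  by apply: NP => /=; rewrite -addnA; apply: leq_trans (leq_addr _ _); near: n;
    exists N.
have /andP[cov1 covC] := cover_number_code Um cP.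
have n0 : (0 < n)%N by near: n; exists 1%N.
have nm : (m + m <= n)%N by near: n; exists (m + m)%N.
have n0R : 0 < n%:R :> R by rewrite ltr0n.
have ln0 : 0 <= ln (cover_number R (cover_refine hull_shift U n)) by rewrite ln_ge0.
rewrite ger0_norm ?divr_ge0// ler_pdivrMr//.
have lnC : ln (cover_number R (cover_refine hull_shift U n)) <= ln #|C|%:R.
  by rewrite ler_ln// posrE (lt_le_trans ltr01)// (le_trans cov1).
rewrite (le_trans lnC)// (le_trans Ce)//.
have : (n + m + m)%:R <= 2 * n%:R :> R by rewrite -natrM ler_nat; lia.
by nra.
Unshelve. all: by end_near. Qed.

Lemma topological_entropy_shift :
  few_words -> topological_entropy R hull_shift = 0%E.
Proof.
move=> uW; rewrite /topological_entropy.
rewrite (_ : [set _ | _ in _] = [set 0%E]) ?ereal_sup1//.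
apply/seteqP; split => [_ [U Uo <-]|_ ->] /=.
  exact: cover_entropy_shift.
exists [set [set: X]].
  by split => [A -> |]; [exact: openT|rewrite bigcup_set1].
apply: cover_entropy_shift => //.
by split => [A -> |]; [exact: openT|rewrite bigcup_set1].
Qed.

End Shift.

(** * Counting squares in residue classes *)

Section Counting.
Local Open Scope nat_scope.

Section Periodic.
Variables (p : pred nat) (Q : nat).
Hypothesis pQ : forall i, p (i + Q) = p i.

Lemma count_period a : count p (iota a Q) = count p (iota 0 Q).
Proof.
elim: a => // a IH; rewrite -{}IH; apply: (@addnI (p a)).
have -> : p a + count p (iota a.+1 Q) = count p (iota a (Q + 1)).
  by rewrite addn1.
by rewrite iotaD count_cat /= pQ addn0 addnC.
Qed.

Lemma count_periods a k : count p (iota a (k * Q)) = k * count p (iota 0 Q).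
Proof.
elim: k a => [|k IH] a; first by rewrite !mul0n.
by rewrite !mulSn iotaD count_cat count_period IH.
Qed.

Lemma count_periodic_le a n : 0 < Q ->
  count p (iota a n) <= (n %/ Q).+1 * count p (iota 0 Q).
Proof.
move=> Q0; rewrite -(count_periods a).
rewrite -(subnKC (ltnW (ltn_ceil n Q0))) iotaD count_cat.
exact: leq_addr.
Qed.

End Periodic.

Lemma count_ltn_fibres (f : nat -> nat) (s : seq nat) B c :
  (forall b, b < B -> count (fun n => f n == b) s <= c) ->
  count (fun n => f n < B) s <= B * c.
Proof.
elim: B => [|B IH] h; first by rewrite (eq_count (a2 := pred0)) ?count_pred0.
rewrite mulSn (leq_trans _ (leq_add (h _ (ltnSn B)) (IH _)))//; last first.
  by move=> b bB; apply: h; lia.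
rewrite -count_predUI; apply: leq_trans (leq_addr _ _).
by apply: sub_count => n /=; lia.
Qed.

Definition sqs Q := undup [seq r ^ 2 %% Q | r <- iota 0 Q].

Lemma mem_sqs Q n : 0 < Q -> n ^ 2 %% Q \in sqs Q.
Proof.
move=> Q0; rewrite mem_undup -modnXm; apply: map_f.
by rewrite mem_iota ltn_mod.
Qed.

Lemma count_sqs Q : count (fun i => i %% Q \in sqs Q) (iota 0 Q) <= size (sqs Q).
Proof.
rewrite -size_filter; apply: uniq_leq_size; first exact/filter_uniq/iota_uniq.
move=> i; rewrite mem_filter mem_iota add0n => /andP[iQ /andP[_ iltQ]].
by rewrite -(modn_small iltQ).
Qed.

Lemma size_sqs_coprime Q q : coprime Q q ->
  size (sqs (Q * q)) <= size (sqs Q) * size (sqs q).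
Proof.
move=> cQq.
have [->|Q0] := posnP Q; first by rewrite mul0n.
have [->|q0] := posnP q; first by rewrite muln0.
have dQ : Q %| Q * q by exact: dvdn_mulr.
have dq : q %| Q * q by exact: dvdn_mull.
pose g a := (a %% Q, a %% q).
rewrite -(size_map g) -(size_allpairs pair); apply: uniq_leq_size.
  rewrite map_inj_in_uniq ?undup_uniq// => a b.
  rewrite !mem_undup => /mapP[a' _ ->] /mapP[b' _ ->] [eQ eq].
  move: eQ eq; rewrite !(modn_dvdm _ dQ) !(modn_dvdm _ dq) => eQ eq.
  by apply/eqP; rewrite chinese_remainder// eQ eq !eqxx.
move=> _ /mapP[a + ->]; rewrite mem_undup => /mapP[r _ ->].
by rewrite /g (modn_dvdm _ dQ) (modn_dvdm _ dq) allpairs_f ?mem_sqs.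
Qed.

(** r and q - r have the same square modulo q. *)
Lemma size_sqs_odd Q : size (sqs (2 * Q).+1) <= Q.+1.
Proof.
set q := (2 * Q).+1.
rewrite -(size_iota 0 Q.+1) -(size_map (fun r => r ^ 2 %% q)).
apply: uniq_leq_size; first exact: undup_uniq.
move=> a; rewrite mem_undup => /mapP[r]; rewrite mem_iota add0n => rq ->.
have [rQ|Qr] := leqP r Q; first by apply/mapP; exists r; rewrite // mem_iota; lia.
apply/mapP; exists (q - r); first by rewrite mem_iota; lia.
apply/eqP; rewrite eqn_mod_dvd; last by rewrite leq_exp2r//; lia.
by rewrite subn_sqr subnKC ?dvdn_mull//; lia.
Qed.

(** Each new factor is odd and coprime to the previous ones, so by the Chinese
remainder theorem it multiplies the proportion of squares by at most 2/3. *)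
Fixpoint sqmod k := if k is j.+1 then sqmod j * (2 * sqmod j).+1 else 1.

Lemma sqmod_gt0 k : 0 < sqmod k.
Proof. by elim: k => //= k IH; rewrite muln_gt0 IH. Qed.

Lemma sqmod_dvd k : sqmod k %| sqmod k.+1.
Proof. exact: dvdn_mulr. Qed.

Lemma size_sqs_sqmod k : size (sqs (sqmod k)) * 3 ^ k <= 2 ^ k * sqmod k.
Proof.
elim: k => //= k IH; have Q0 := sqmod_gt0 k.
set Q := sqmod k in IH Q0 *.
have co : coprime Q (2 * Q).+1 by rewrite -addn1 /coprime gcdnMDl gcdn1.
rewrite (leq_trans (leq_mul (size_sqs_coprime co) (leqnn (3 ^ k.+1))))//.
have := leq_mul (leqnn (3 * Q.+1)) IH.
have := leq_mul (leqnn (size (sqs Q) * 3 ^ k.+1)) (size_sqs_odd Q).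
have : 3 * Q.+1 * (2 ^ k * Q) <= 2 * (2 * Q).+1 * (2 ^ k * Q).
  by apply: leq_mul => //; lia.
rewrite !expnS; set s := size _; set s' := size _; lia.
Qed.

(** One of the two valuations is at least the half of their sum. *)
Lemma pow2_dvd_mul m a b : 2 ^ (m + m) %| a * b -> (2 ^ m %| a) || (2 ^ m %| b).
Proof.
have [->|a0] := posnP a; first by rewrite dvdn0.
have [->|b0] := posnP b; first by rewrite dvdn0 orbT.
rewrite !pfactor_dvdn ?muln_gt0 ?a0 ?b0// lognM//.
by have [//|] := leqP m (logn 2 a); lia.
Qed.

Lemma sqr_eq_mod_pow4 m s n : n ^ 2 = s ^ 2 %[mod 4 ^ m] ->
  n = s %[mod 2 ^ m] \/ n + s = 0 %[mod 2 ^ m].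
Proof.
have -> : 4 ^ m = 2 ^ (m + m) by rewrite addnn -mul2n expnM.
wlog sn : n s / s <= n => [H e|].
  have [|/ltnW ns] := leqP s n; first by move/H; apply.
  have [->|] := H _ _ ns (esym e); first by left.
  by rewrite addnC; right.
move=> /eqP; rewrite eqn_mod_dvd ?leq_exp2r// subn_sqr => /pow2_dvd_mul.
move=> /orP[]; first by rewrite -eqn_mod_dvd// => /eqP; left.
by rewrite /dvdn => /eqP ->; right; rewrite mod0n.
Qed.

Lemma count_congr a m : count (fun n => n == a %[mod 2 ^ m]) (iota 0 (4 ^ m)) = 2 ^ m.
Proof.
have -> : 4 ^ m = 2 ^ m * 2 ^ m by rewrite -expnMn.
rewrite count_periods => [|i]; last by rewrite modnDr.
rewrite -[RHS]muln1; congr (_ * _).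
have am : a %% 2 ^ m \in iota 0 (2 ^ m).
  by rewrite mem_iota ltn_mod expn_gt0.
rewrite -[RHS](_ : count_mem (a %% 2 ^ m) (iota 0 (2 ^ m)) = 1); last first.
  by rewrite count_uniq_mem ?iota_uniq// am.
apply: eq_in_count => i; rewrite mem_iota add0n => /andP[_ im].
by rewrite (modn_small im).
Qed.

(** If n^2 = s^2 modulo 4^m then 2^m divides n - s or n + s, so that n lies in one of
two classes modulo 2^m. *)
Lemma count_sqr_fibre m L b :
  count (fun n => (n ^ 2 + L) %% 4 ^ m == b) (iota 0 (4 ^ m)) <= 2 * 2 ^ m.
Proof.
set p := (fun n => _).
have [/hasP[s _ ps]|] := boolP (has p (iota 0 (4 ^ m))); last first.
  by rewrite has_count -leqNgt leqn0 => /eqP ->.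
pose s' := (2 ^ m - s %% 2 ^ m).
have -> : 2 * 2 ^ m = count (fun n => n == s %[mod 2 ^ m]) (iota 0 (4 ^ m)) +
    count (fun n => n == s' %[mod 2 ^ m]) (iota 0 (4 ^ m)).
  by rewrite !count_congr addnn mul2n.
rewrite -count_predUI; apply: leq_trans (leq_addr _ _).
apply: sub_count => n pn /=.
have /sqr_eq_mod_pow4[->|] : n ^ 2 = s ^ 2 %[mod 4 ^ m].
- by apply/eqP; rewrite -(eqn_modDr L) (eqP pn) (eqP ps).
- by rewrite eqxx.
- have s2 : s %% 2 ^ m <= 2 ^ m by rewrite ltnW// ltn_mod expn_gt0.
  move=> ns; apply/orP; right; rewrite -(eqn_modDr s) ns mod0n /s'.
  by rewrite -modnDmr subnK// modnn.
Qed.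

Lemma count_sqr_window m L N : 4 ^ m %| N ->
  count (fun n => (n ^ 2 + L) %% 4 ^ m < 2 * L) (iota 1 N) * 2 ^ m <= 4 * L * N.
Proof.
move=> /dvdnP[k ->]; set p := (fun n => _).
have pP i : p (i + 4 ^ m) = p i.
  by rewrite /p -modnDml -modnXm modnDr modnXm modnDml.
rewrite count_periods//.
have : count p (iota 0 (4 ^ m)) <= 2 * L * (2 * 2 ^ m).
  by apply: count_ltn_fibres => b _; exact: count_sqr_fibre.
move: (count p _) => c cL; have -> : 4 ^ m = 2 ^ m * 2 ^ m by rewrite -expnMn.
have := leq_mul (leqnn (k * 2 ^ m)) cL; lia.
Qed.

End Counting.

(** * The Toeplitz sequence *)

Section Stages.
Local Open Scope nat_scope.

(** The exponent exceeds the reach L of the stage, because only a proportion of order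
L / 2^m of the squares may fall within distance L of a multiple of 4^m. The
offset k + 7 makes the losses of all stages summable with a small total. *)
Definition stage_exp L k := L + k + 7.
Definition stage_mod L k := 4 ^ stage_exp L k * sqmod k.

(** The next stage reaches beyond the squares of all n <= [modulus j]. *)
Fixpoint reach k :=
  if k is j.+1 then (stage_mod (reach j) j ^ 2).+1 else 1.

Definition modulus k := stage_mod (reach k) k.

Lemma reachS k : reach k.+1 = (modulus k ^ 2).+1. Proof. by []. Qed.

Lemma reach_gt0 k : 0 < reach k. Proof. by case: k. Qed.

Lemma modulus_gt0 k : 0 < modulus k.
Proof. by rewrite muln_gt0 expn_gt0 sqmod_gt0. Qed.

Lemma reach_le_exp k : 2 ^ (k + 7) * reach k <= 2 ^ stage_exp (reach k) k.
Proof.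
rewrite /stage_exp -addnA [reach k + _]addnC [leqRHS]expnD.
by apply: leq_mul => //; apply/ltnW; rewrite ltn_expl.
Qed.

Lemma reach_le_modulus k : 2 * reach k <= modulus k.
Proof.
have h := reach_le_exp k; rewrite (leq_trans (leq_mul _ (leqnn _)) (leq_trans h _))//.
  by rewrite -{1}(expn1 2) leq_exp2l//; lia.
rewrite /modulus /stage_mod (leq_trans _ (leq_pmulr _ (sqmod_gt0 k)))//.
by rewrite leq_exp2r// /stage_exp; lia.
Qed.

Lemma reach_ltS k : reach k < reach k.+1.
Proof.
have := reach_le_modulus k; have := reach_gt0 k; rewrite reachS; nia.
Qed.

Lemma ltn_reach k : k < reach k.
Proof. by elim: k => // k IH; have := reach_ltS k; lia. Qed.

Lemma modulus_dvd j k : j <= k -> modulus j %| modulus k.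
Proof.
apply: (@homo_leq _ _ (fun a b => a %| b)) => // {j k}; first exact: dvdn_trans.
move=> k; apply: dvdn_mul; last exact: sqmod_dvd.
by rewrite dvdn_exp2l// /stage_exp leq_add2r leq_add// ltnW// reach_ltS.
Qed.

End Stages.

(** Adding [reach k] moves the interval [-reach k, reach k) to the start of a period, so
that congruence to a member of it becomes a single comparison. *)
Definition filled (k : nat) (j : int) : bool :=
  modz (j + (reach k)%:Z) (modulus k)%:Z < (2 * reach k)%N%:Z.

(** The representative of j in the interval of length [modulus k] starting at
- [reach k]. *)
Definition residue (k : nat) (j : int) : int :=
  modz (j + (reach k)%:Z) (modulus k)%:Z - (reach k)%:Z.

Definition first_filled k j := filled k j /\ forall l, (l < k)%N -> ~~ filled l j.

Definition moebius_square (j : int) := exists2 n : nat, j = (n ^ 2)%N%:Z & moebius n = 1.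

Definition mtoeplitz (j : int) : bool :=
  `[< exists2 k, first_filled k j & moebius_square (residue k j) >].

Lemma filled_congr k i j : (i = j %[mod (modulus k)%:Z])%Z ->
  filled k i = filled k j /\ residue k i = residue k j.
Proof.
move=> ij; rewrite /filled /residue.
by rewrite -(modzDml i) ij modzDml.
Qed.

Lemma congr_modulus j k (s t : int) : (j <= k)%N ->
  (s = t %[mod (modulus k)%:Z])%Z -> (s = t %[mod (modulus j)%:Z])%Z.
Proof.
move=> jk /eqP; rewrite eqz_mod_dvd => st; apply/eqP; rewrite eqz_mod_dvd.
by apply: dvdz_trans st; exact: modulus_dvd.
Qed.

(** Moduli of earlier stages divide that of stage k, so two integers congruent modulo
[modulus k] are treated alike by all stages up to k. *)
Lemma mtoeplitz_congr k i j : filled k i -> (i = j %[mod (modulus k)%:Z])%Z ->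
  mtoeplitz i = mtoeplitz j.
Proof.
have half (s t : int) : filled k s -> (s = t %[mod (modulus k)%:Z])%Z ->
    mtoeplitz s -> mtoeplitz t.
  move=> fs st /asboolP[l [sl lmin] lv].
  have lk : (l <= k)%N by rewrite leqNgt; apply/negP => /lmin; rewrite fs.
  have [flt rlt] := filled_congr (congr_modulus lk st).
  apply/asboolP; exists l; last by rewrite -rlt.
  split; first by rewrite -flt.
  move=> m ml; have mk : (m <= k)%N by exact: leq_trans (ltnW ml) lk.
  by have [<- _] := filled_congr (congr_modulus mk st); exact: lmin.
move=> fi ij; have fj : filled k j by have [<- _] := filled_congr ij.
by apply/idP/idP; [exact: half|apply: half].
Qed.

Lemma filled_small k (j : int) : (`|j|%N < reach k)%N ->
  filled k j /\ residue k j = j.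
Proof.
move=> jk; rewrite /filled /residue modz_small; last first.
  by have := reach_le_modulus k; lia.
by split; lia.
Qed.

Lemma toeplitz_mtoeplitz : toeplitz mtoeplitz.
Proof.
move=> k; exists (modulus k); first exact: modulus_gt0.
move=> t i ik; apply/esym/(@mtoeplitz_congr k).
  by apply: (filled_small _).1; rewrite (ltn_trans ik) ?ltn_reach.
by rewrite addrC modzMDl.
Qed.

(** A stage beyond K only puts 1 at squares modulo its own modulus, which is a multiple
of [sqmod K]. *)
Lemma mtoeplitz_transfer K (s t : int) : (s = t %[mod (modulus K)%:Z])%Z ->
  mtoeplitz s -> mtoeplitz t \/ exists n : nat, (s = (n ^ 2)%N%:Z %[mod (sqmod K)%:Z])%Z.
Proof.
move=> st us; have /asboolP[k [fk kmin] [n sn _]] := us.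
have [kK|Kk] := leqP k K.
  by left; rewrite -(mtoeplitz_congr fk (congr_modulus kK st)).
right; exists n; apply/eqP; rewrite eqz_mod_dvd -sn /residue.
apply: (@dvdz_trans (modulus k)%:Z).
  apply: (@dvdn_trans (modulus K)); first exact: dvdn_mull.
  exact/modulus_dvd/ltnW.
rewrite opprB addrA -eqz_mod_dvd; apply/eqP.
by rewrite modz_mod.
Qed.

(** Under these hypotheses the first stage that fills n^2 is stage K + 1, where n^2 is
its own representative. *)
Lemma mtoeplitz_sqr K n : (n <= modulus K)%N ->
  (forall k, (k <= K)%N -> ~~ filled k (n ^ 2)%N%:Z) ->
  mtoeplitz (n ^ 2)%N%:Z = (moebius n == 1).
Proof.
move=> nK nf.
have [fn rn] : filled K.+1 (n ^ 2)%N%:Z /\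
    residue K.+1 (n ^ 2)%N%:Z = (n ^ 2)%N%:Z.
  by apply: filled_small; rewrite reachS absz_nat ltnS leq_exp2r.
apply/asboolP/eqP => [[k [fk kmin] [n' kn' n'1]]|n1]; last first.
  by exists K.+1; [split => // l; rewrite ltnS; exact: nf|rewrite rn; exists n].
have kK : k = K.+1.
  apply/eqP; rewrite eqn_leq; apply/andP; split; rewrite leqNgt; apply/negP.
    by move/kmin; rewrite fn.
  by rewrite ltnS => /nf; rewrite fk.
move: kn'; rewrite kK rn => -[/eqP]; rewrite eqn_exp2r// => /eqP ->.
exact: n'1.
Qed.

(** * Word complexity *)

Section Coding.
Variables K n : nat.
Let Q := sqmod K.
Let M := modulus K.

Definition window_start (t : int) : 'I_M.-1.+1 := inord (absz (modz t M%:Z)).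

Definition square_positions (r : nat) :=
  [seq i <- iota 0 n | ((r + i) %% Q)%N \in sqs Q].

(** The word of length n at t is recovered from t modulo [modulus K] and from the
symbols at the positions that are squares modulo [sqmod K]. *)
Definition window_code (t : int) :
    'I_M.-1.+1 * {ffun 'I_((n %/ Q).+1 * size (sqs Q)) -> bool} :=
  (window_start t,
   [ffun b : 'I_ _ => mtoeplitz (t + (nth 0 (square_positions (window_start t)) b)%:Z)]).

Lemma window_startE t : (window_start t)%:Z = modz t M%:Z.
Proof.
have M0 := modulus_gt0 K; rewrite -/M in M0.
have := modz_ge0 t (_ : M%:Z != 0); have := ltz_pmod t (_ : 0 < M%:Z).
move=> /(_ ltac:(lia)) h1 /(_ ltac:(lia)) h2.
by rewrite /window_start inordK; lia.
Qed.

Lemma size_square_positions r :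
  (size (square_positions r) <= (n %/ Q).+1 * size (sqs Q))%N.
Proof.
rewrite size_filter.
have -> : count (fun i => (r + i) %% Q \in sqs Q)%N (iota 0 n) =
    count (fun i => i %% Q \in sqs Q)%N (iota r n).
  by rewrite -{2}(addn0 r) iotaDl count_map.
have pQ i : (((i + Q) %% Q)%N \in sqs Q) = ((i %% Q)%N \in sqs Q).
  by rewrite modnDr.
rewrite (leq_trans (count_periodic_le pQ r n (sqmod_gt0 K)))//.
by rewrite leq_mul// count_sqs.
Qed.

(** A symbol 1 that a stage up to K puts in the word at s is repeated in the word at t;
any other symbol 1 is listed in the second component of the code. *)
Lemma window_codeP s t : window_code s = window_code t ->
  forall i, (i < n)%N -> mtoeplitz (s + i%:Z) = mtoeplitz (t + i%:Z).
Proof.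
have half s' t' : window_code s' = window_code t' -> forall i, (i < n)%N ->
    mtoeplitz (s' + i%:Z) -> mtoeplitz (t' + i%:Z).
  move=> [e1 e2] i im ui.
  have st : (s' = t' %[mod M%:Z])%Z by rewrite -!window_startE e1.
  have sti : (s' + i%:Z = t' + i%:Z %[mod M%:Z])%Z.
    by rewrite -(modzDml s') st modzDml.
  have [//|[m /esym sm]] := mtoeplitz_transfer sti ui.
  set r := window_start t' in e1 e2; rewrite e1 in e2.
  have iF : i \in square_positions r.
    rewrite mem_filter mem_iota im !andbT.
    suff -> : ((r + i) %% Q = m ^ 2 %% Q)%N by rewrite mem_sqs ?sqmod_gt0.
    apply/eqP; rewrite -eqz_nat -!modz_nat sm -e1 eqz_mod_dvd.
    apply: (@dvdz_trans M%:Z); first by rewrite dvdzE/= dvdn_mull.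
    by rewrite -eqz_mod_dvd PoszD window_startE modzDml.
  have iB : (index i (square_positions r) < (n %/ Q).+1 * size (sqs Q))%N.
    by rewrite (leq_trans _ (size_square_positions r))// index_mem.
  move/ffunP : e2 => /(_ (Ordinal iB)).
  by rewrite !ffunE /= nth_index// => <-.
move=> st i im; apply/idP/idP; first exact: half.
by apply: half.
Qed.
End Coding.

Lemma few_words_mtoeplitz (R : realType) : few_words R mtoeplitz.
Proof.
move=> e e0.
have e40 : 0 < e / 2 by rewrite divr_gt0.
have [K _ KP] : \forall K \near \oo, (2 / 3 : R) ^+ K <= e / 2.
  have h : (2 / 3 : R) ^+ K @[K --> \oo] --> 0.
    by apply: cvg_expr; rewrite ger0_norm; lra.
  by move/cvgr0Pnorm_le : h => /(_ _ e40); apply: filterS => K; rewrite ger0_norm// exprn_ge0.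
have {KP} KP := KP K (leqnn K).
set Q := sqmod K; set S := size (sqs Q).
have := modulus_gt0 K; move eM : (modulus K) => M M0.
near=> n.
exists _, (@window_code K n); split; first exact: window_codeP.
rewrite card_prod card_ord card_ffun card_bool card_ord prednK ?modulus_gt0//.
rewrite eM -/Q -/S.
have ln2 : 0 <= ln (2 : R) <= 1.
  by rewrite ln_ge0 ?ler1n//= -[2](natrD _ 1 1) le_ln1Dx.
rewrite natrM lnM ?posrE ?ltr0n ?expn_gt0// natrX lnXn// -[ln 2 *+ _]mulr_natl natrM.
have n0 : 0 <= n%:R :> R by [].
have S0 : 0 <= S%:R :> R by [].
have nQ : (n %/ Q)%:R * S%:R <= e / 2 * n%:R :> R.
  have Q0 : 0 < Q%:R :> R by rewrite ltr0n sqmod_gt0.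
  have nQn : (n %/ Q)%:R * Q%:R <= n%:R :> R by rewrite -natrM ler_nat leq_divM.
  have SK : S%:R <= e / 2 * Q%:R :> R.
    have : S%:R * 3 ^+ K <= 2 ^+ K * Q%:R :> R.
      by rewrite -!natrX -!natrM ler_nat size_sqs_sqmod.
    rewrite -ler_pdivlMr ?exprn_gt0// mulrAC -expr_div_n => h.
    by rewrite (le_trans h)// ler_wpM2r// ltW.
  have := ler_wpM2l (ler0n R (n %/ Q)) SK.
  have := ler_wpM2l (ltW e40) nQn; lra.
have nM : ln M%:R + S%:R <= e / 2 * n%:R :> R.
  rewrite -ler_pdivrMl// ; near: n; exact: nbhs_infty_ger.
rewrite -natr1 mulrDl mul1r [_ * ln 2]mulrC.
have : ln 2 * ((n %/ Q)%:R * S%:R + S%:R) <= (n %/ Q)%:R * S%:R + S%:R :> R.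
  by rewrite ler_piMl ?addr_ge0 ?mulr_ge0//; case/andP: ln2.
lra.
Unshelve. all: by end_near. Qed.

(** * Correlation with the Moebius function *)

(** A lower bound for |mu(n)| that can be summed over n. *)
Lemma moebius_sqr_divisor N n : (0 < n <= N)%N ->
  (1 <= `|moebius n| + \sum_(2 <= d < N.+1) (d ^ 2 %| n))%N.
Proof.
move=> /andP[n0 nN]; rewrite /moebius n0 /=.
have [_|/allPn[p]] := boolP (all _ _).
  by rewrite abszX /= exp1n.
rewrite -logn_gt0 => p0 p1.
have pn : (p ^ 2 %| n)%N.
  by rewrite (dvdn_trans _ (pfactor_dvdnn p n))// dvdn_exp2l//; lia.
have p2 : (1 < p)%N.
  by move: p0; rewrite logn_gt0 mem_primes => /andP[/prime_gt1].
have pN : (p < N.+1)%N.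
  rewrite ltnS (leq_trans _ nN)//; apply: dvdn_leq => //.
  by apply: dvdn_trans pn; exact: dvdn_exp.
rewrite (bigD1_seq p) ?mem_index_iota ?p2 ?pN ?iota_uniq//= pn.
exact: leq_trans (leq_addl _ _).
Qed.

Section Bounds.
Context (R : realType).

(** 1/4 for d = 2, and 1/(d-1) - 1/d, which telescopes, bounds the later terms. *)
Lemma sum_inv_sqr N : \sum_(2 <= d < N.+1) (d ^ 2)%:R^-1 <= 3 / 4 :> R.
Proof.
have h n : \sum_(2 <= d < n.+3) (d ^ 2)%:R^-1 <= 3 / 4 - n.+2%:R^-1 :> R.
  elim: n => [|n IH]; first by rewrite big_nat1; lra.
  rewrite big_nat_recr//=; apply: le_trans (lerD IH (lexx _)) _.
  have n0 : 0 < n.+2%:R :> R by [].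
  rewrite natrX -(natr1 n.+2); set x : R := n.+2%:R in n0 *.
  have -> : 3 / 4 - (x + 1)^-1 = 3 / 4 - x^-1 + (x * (x + 1))^-1.
    by field; rewrite !gt_eqF//; lra.
  by rewrite lerD2l lef_pV2 ?posrE; nra.
case: N => [|[|n]]; [by rewrite big_geq//; lra|by rewrite big_geq//; lra|].
by apply: le_trans (h n) _; rewrite gerBl.
Qed.

(** The left-hand side bounds the number of n <= N that are not squarefree. *)
Lemma sum_sqr_divisors N :
  (\sum_(1 <= n < N.+1) \sum_(2 <= d < N.+1) (d ^ 2 %| n))%N%:R
    <= 3 / 4 * N%:R :> R.
Proof.
rewrite exchange_big_nat natr_sum.
apply: le_trans (ler_wpM2r (ler0n R N) (sum_inv_sqr N)).
rewrite big_distrl /=; apply: ler_sum_nat => d /andP[d2 _].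
rewrite -divn_count_dvd ler_pdivlMl ?ltr0n ?expn_gt0; last by lia.
by rewrite -natrM ler_nat mulnC leq_divM.
Qed.

Lemma sum_filled_sqr k K : (k <= K)%N ->
  (\sum_(1 <= n < (modulus K).+1) filled k (n ^ 2)%N%:Z)%N%:R
    <= (modulus K)%:R / 2 ^+ (k + 5) :> R.
Proof.
move=> kK; set N := modulus K.
rewrite ler_pdivlMr ?exprn_gt0// -natrX -natrM ler_nat.
set m := stage_exp (reach k) k; set L := reach k.
have mN : (4 ^ m %| N)%N.
  by apply: dvdn_trans (modulus_dvd kK); exact: dvdn_mulr.
have cN := count_sqr_window L mN.
have : (\sum_(1 <= n < N.+1) filled k (n ^ 2)%N%:Z <=
    count (fun n => (n ^ 2 + L) %% 4 ^ m < 2 * L) (iota 1 N))%N.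
  rewrite -sum1_count [leqRHS]big_mkcond /index_iota subn1 /=.
  apply: leq_sum => n _; rewrite /filled -PoszD modz_nat ltz_nat -/L.
  have [h|//] := ltnP; rewrite ifT//; apply: leq_ltn_trans h.
  have -> : ((n ^ 2 + L) %% 4 ^ m = (n ^ 2 + L) %% modulus k %% 4 ^ m)%N.
    by rewrite modn_dvdm// /modulus -/m dvdn_mulr.
  exact: leq_mod.
have := reach_le_exp k; rewrite -/L -/m.
have := reach_gt0 k; rewrite -/L.
set c := count _ _ in cN *; set s := (\sum_(1 <= _ < _) _)%N.
rewrite (_ : (k + 7 = (k + 5) + 2)%N) ?[(2 ^ (_ + 2))%N]expnD; last lia.
move=> L0 LE sc.
have h1 : (s * (2 ^ (k + 5) * 2 ^ 2 * L) <= 4 * L * N)%N.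
  by apply: leq_trans cN; exact: (leq_mul sc LE).
rewrite -(@leq_pmul2l (4 * L)); last by rewrite muln_gt0.
by apply: leq_trans h1; set e := (2 ^ (k + 5))%N; lia.
Qed.

Lemma sum_filled_sqr_stages K :
  (\sum_(1 <= n < (modulus K).+1) \sum_(k < K.+1) filled k (n ^ 2)%N%:Z)%N%:R
    <= (modulus K)%:R / 16 :> R.
Proof.
rewrite exchange_big natr_sum.
have geo m : \sum_(k < m) (2 ^+ (k + 5))^-1 = 16^-1 - (2 ^+ (m + 4))^-1 :> R.
  elim: m => [|m IH]; first by rewrite big_ord0 add0n; field.
  rewrite big_ord_recr /= {}IH !exprD [2 ^+ m.+1]exprS.
  by field; rewrite expf_neq0.
apply: (@le_trans _ _ (\sum_(k < K.+1) (modulus K)%:R / 2 ^+ (k + 5))).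
  by apply: ler_sum => k _; apply: sum_filled_sqr; rewrite -ltnS.
rewrite -mulr_sumr geo ler_wpM2l// gerBl.
by rewrite invr_ge0 exprn_ge0.
Qed.

(** With [N] for the modulus: the squarefree numbers give N/4, and each spoiled n costs
at most 2, for a total of 2 N/16. *)
Lemma sum_moebius_mtoeplitz K :
  (modulus K)%:R / 8 <= \sum_(1 <= n < (modulus K).+1)
    (moebius n)%:~R * (if mtoeplitz (n ^ 2)%N%:Z then 1 else - 1) :> R.
Proof.
set N := modulus K.
have term n : (1 <= n < N.+1)%N ->
    1 - (\sum_(2 <= d < N.+1) (d ^ 2 %| n))%N%:R
      - 2 * (\sum_(k < K.+1) filled k (n ^ 2)%N%:Z)%N%:R
    <= (moebius n)%:~R * (if mtoeplitz (n ^ 2)%N%:Z then 1 else - 1) :> R.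
  rewrite ltnS => nN.
  have := moebius_sqr_divisor nN; rewrite -(ler_nat R) natrD.
  set a : R := (\sum_(_ <= _ < _) _)%:R => na.
  set b := (\sum_(_ < _) _)%N.
  have mu1 : [\/ moebius n = 1, moebius n = -1 | moebius n = 0].
    rewrite /moebius; case: ifP => _; last by constructor 3.
    by rewrite -signr_odd; case: odd; [constructor 2|constructor 1].
  have b0 : 0 <= b%:R :> R by [].
  (* [b] counts the stages that spoil n. *)
  have [b1|] := posnP b.
    have nf k : (k <= K)%N -> ~~ filled k (n ^ 2)%N%:Z.
      move=> kK; move/eqP: b1; rewrite sum_nat_eq0 => /forallP/(_ (inord k)).
      by rewrite inordK ?ltnS//= eqb0.
    rewrite (mtoeplitz_sqr (proj2 (andP nN)) nf).
    by case: mu1 na => -> /=; rewrite /= ?mulr0z ?mulr1z ?mulrN1z; lra.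
  rewrite -(ltr_nat R) -[0%N%:R]/0 => b1.
  have {}b1 : 1 <= b%:R :> R by rewrite ler1n -(ltr0n R).
  by case: mu1 na => -> /=; case: (mtoeplitz _); rewrite /= ?mulr0z ?mulr1z ?mulrN1z; lra.
apply: le_trans (ler_sum_nat term).
rewrite !sumrB -mulr_sumr -!natr_sum sumr_const_nat subn1 /=.
have := sum_sqr_divisors N; have := sum_filled_sqr_stages K; rewrite -/N; lra.
Qed.

End Bounds.

Theorem corollary1p2 (R : realType) :
  exists (X : topologicalType) (T : homeo X X),
    [/\ compact [set: X], metrizable R X, minimal T,
        topological_entropy R T = 0%E
      & exists (f : X -> R) (p : nat -> nat) (x : X),
          [/\ continuous f, polynomial_map p
            & ~ ((fun N : nat =>
                   N%:R^-1 * \sum_(1 <= n < N.+1)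
                     (moebius n)%:~R * f (homeo_pow T (p n) x))
                 @ \oo --> (0 : R))]].
Proof.
exists (hull R mtoeplitz), (hull_shift R mtoeplitz); split.
- exact: compact_hull.
- exact: metrizable_hull.
- exact/minimal_hull_shift/toeplitz_mtoeplitz.
- exact/topological_entropy_shift/few_words_mtoeplitz.
exists (fun y => if sval y 0 then 1 else - 1), (fun n => n ^ 2)%N, (hull_base R mtoeplitz).
split.
- move=> y; apply: (@near_cst_continuous _ _ (if sval y 0 then 1 else - 1 : R)).
  by apply: filterS (near_agree y 1) => z yz; rewrite yz.
- by exists 'X^2 => n _; rewrite hornerXn natrX.
move=> /cvgrPdist_lt /(_ (1 / 8) ltac:(lra)) [N0 _ N0P].
have N0M : (N0 <= modulus N0)%N.
  have := ltn_reach N0; have := reach_le_modulus N0; lia.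
have := N0P _ N0M; rewrite sub0r normrN ltNge => /negP; apply.
have M0 : 0 < (modulus N0)%:R :> R by rewrite ltr0n modulus_gt0.
apply: le_trans (ler_norm _); rewrite ler_pdivlMl// mul1r.
apply: le_trans (sum_moebius_mtoeplitz R N0) _.
rewrite le_eqVlt; apply/orP; left; apply/eqP/eq_bigr => n _.
by rewrite homeo_pow_shift /= add0r.
Qed.
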